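(* Let $L$ be a non-trivial finite group. Then the lamplighter group $L\wr\mathbb{Z}$ has infinite strong cop number, i.e. $\operatorname{sCop}(L\wr\mathbb{Z})=\infty$.
   Context: $L\wr\mathbb{Z}:=L^{\oplus\mathbb{Z}}\rtimes\mathbb{Z}$ is the restricted wreath product, with $\mathbb{Z}$ acting by index shifts. Convention: $\mathbb{N}=\mathbb{Z}_{\geq 1}$. Graphs are connected, undirected, without double edges or loops, with the path metric on vertices. Game. Let $\Gamma$ be a graph. The cops and robbers game on $\Gamma$ has parameters: number of cops $n\in\mathbb{N}$, base point (treasure) $v\in\Gamma$ a vertex, cop speed $\sigma\in\mathbb{N}$, robber speed $\psi\in\mathbb{N}$, cop reach $\rho\in\mathbb{N}$, robber radius $R\in\mathbb{N}$. It is a two-player game with perfect information. First the cop player chooses $n$ vertices as starting positions of the cops, then the robber chooses a vertex as starting position. The players then alternate turns, starting with the cops. In each turn the cop player may move each cop along a path of length at most $\sigma$ to some vertex; then the robber moves along a path of length at most $\psi$ ending in a vertex. One cop move followed by one robber move is a stage. The cop player wins if the robber is captured, i.e. at some time during some stage the robber's position is at distance at most $\rho$ from some cop's position (this includes every vertex traversed by the robber during a move: the robber must traverse the path edge by edge without ever coming within distance $\rho$ of a cop), or if the cops eventually defend $v$, i.e. after some finite initial time the robber never enters the closed ball of radius $R$ around $v$. Otherwise the robber wins. The strong cop number $\operatorname{sCop}(\Gamma)\in\mathbb{N}\cup\{\infty\}$ is the infimum (with $\inf\emptyset=\infty$) of all $n\in\mathbb{N}$ such that $\forall v\in\Gamma,\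 \exists\sigma\in\mathbb{N},\ \forall\psi\in\mathbb{N},\ \exists\rho\in\mathbb{N},\ \forall R\in\mathbb{N}$: the cop player has a winning strategy with $n$ cops. This number is invariant under quasi-isometry, so for a finitely generated group $G$ one sets $\operatorname{sCop}(G):=\operatorname{sCop}(\operatorname{Cay}(G,S))$ for any finite generating set $S$. *)

(* Defs.v *)
From HB Require Import structures.
From mathcomp Require Import all_boot all_order all_algebra all_fingroup.
From mathcomp Require Import finmap.
From mathcomp Require Import boolp classical_sets constructive_ereal.

Set Implicit Arguments.
Unset Strict Implicit.
Unset Printing Implicit Defensive.

Import GRing.Theory.

(* The restricted wreath product L wr Z: a pair (f, m) is a finitely supported
   lamp configuration f together with the position m of the lamplighter, and
   Z acts on configurations by index shifts, (m . g)(k) = g(k - m). *)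
Section Lamplighter.
Variable L : groupType.

Definition lampconf : choiceType := {fsfun int -> L with 1%g}.
Definition lamplighter : Type := lampconf * int.

HB.instance Definition _ := Choice.on lamplighter.

Definition lc_one : lampconf := [fsfun with 1%g].

Definition lc_mul (f g : lampconf) : lampconf :=
  [fsfun k in (finsupp f `|` finsupp g)%fset => (f k * g k)%g | 1%g].

Definition lc_inv (f : lampconf) : lampconf :=
  [fsfun k in finsupp f => (f k)^-1%g | 1%g].

Definition lc_shift (m : int) (g : lampconf) : lampconf :=
  [fsfun k in [fset (i + m)%R | i in finsupp g]%fset => g (k - m)%R | 1%g].

Lemma lc_oneE k : lc_one k = 1%g.
Proof. by rewrite /lc_one fsfunE. Qed.

Lemma lc_mulE f g k : lc_mul f g k = (f k * g k)%g.
Proof.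
rewrite /lc_mul fsfunE inE; case: (finsuppP f k) => [_|_] //=.
by case: (finsuppP g k) => [_|_] //=; rewrite mulg1.
Qed.

Lemma lc_invE f k : lc_inv f k = (f k)^-1%g.
Proof.
by rewrite /lc_inv fsfunE; case: (finsuppP f k) => [_|_] //=; rewrite invg1.
Qed.

Lemma lc_shiftE m g k : lc_shift m g k = g (k - m)%R.
Proof.
rewrite /lc_shift fsfunE; case: ifPn => // kNg.
apply/esym/fsfun_dflt; apply: contra kNg => kg.
by apply/imfsetP; exists (k - m)%R => //=; rewrite subrK.
Qed.

Definition ll_one : lamplighter := (lc_one, 0%R).
Definition ll_mul (x y : lamplighter) : lamplighter :=
  (lc_mul x.1 (lc_shift x.2 y.1), (x.2 + y.2)%R).
Definition ll_inv (x : lamplighter) : lamplighter :=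
  (lc_shift (- x.2) (lc_inv x.1), (- x.2)%R).

Lemma ll_mulA : associative ll_mul.
Proof.
move=> [f m] [g n] [h p]; rewrite /ll_mul /=; congr (_, _); last exact: addrA.
by apply/fsfunP=> k; rewrite !(lc_mulE, lc_shiftE) mulgA opprD addrA.
Qed.

Lemma ll_mul1 : left_id ll_one ll_mul.
Proof.
move=> [f m]; rewrite /ll_mul /=; congr (_, _); last exact: add0r.
by apply/fsfunP=> k; rewrite lc_mulE lc_shiftE lc_oneE mul1g subr0.
Qed.

Lemma ll_1mul : right_id ll_one ll_mul.
Proof.
move=> [f m]; rewrite /ll_mul /=; congr (_, _); last exact: addr0.
by apply/fsfunP=> k; rewrite lc_mulE lc_shiftE lc_oneE mulg1.
Qed.

Lemma ll_mulV : left_inverse ll_one ll_inv ll_mul.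
Proof.
move=> [f m]; rewrite /ll_mul /=; congr (_, _); last exact: addNr.
by apply/fsfunP=> k; rewrite lc_mulE !lc_shiftE lc_invE lc_oneE mulVg.
Qed.

Lemma ll_Vmul : right_inverse ll_one ll_inv ll_mul.
Proof.
move=> [f m]; rewrite /ll_mul /=; congr (_, _); last exact: addrN.
apply/fsfunP=> k.
by rewrite lc_mulE !lc_shiftE lc_invE lc_oneE opprK subrK mulgV.
Qed.

HB.instance Definition _ :=
  isGroup.Build lamplighter ll_mulA ll_mul1 ll_1mul ll_mulV ll_Vmul.

End Lamplighter.

Record graph := Graph {
  vertex :> choiceType;
  adj : rel vertex;
  adj_sym : symmetric adj;
  adj_irr : irreflexive adj;
  graph_connected :
    forall x y : vertex, exists p, path adj x p /\ last x p = y }.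

Section PathMetric.
Variable G : graph.
Implicit Types x y : G.

Definition has_path_of_length x y (k : nat) : bool :=
  `[< exists p, [/\ path (@adj G) x p, last x p = y & size p = k] >].

Lemma has_path_ex x y : exists k, has_path_of_length x y k.
Proof.
have [p [px py]] := graph_connected x y.
by exists (size p); apply/asboolP; exists p.
Qed.

Definition gdist x y : nat := ex_minn (has_path_ex x y).

End PathMetric.

Section Cayley.
Variable G : groupType.

Definition symgen (S : {fset G}) : pred G :=
  [pred a | (a \in S) || (a^-1%g \in S)].

Definition generates (S : {fset G}) : Prop :=
  forall x : G, exists s : seq G,
    all (symgen S) s /\ x = (\prod_(a <- s) a)%g.

Definition cay_adj (S : {fset G}) : rel G :=
  [rel x y | (x != y) && symgen S (x^-1 * y)%g].

Lemma cay_adj_sym S : symmetric (cay_adj S).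
Proof.
move=> x y; rewrite /cay_adj /symgen /= eq_sym.
have -> : (y^-1 * x = (x^-1 * y)^-1)%g by rewrite invgM invgK.
by rewrite invgK orbC.
Qed.

Lemma cay_adj_irr S : irreflexive (cay_adj S).
Proof. by move=> x; rewrite /cay_adj /= eqxx. Qed.

Lemma cay_connected S : generates S ->
  forall x y : G, exists p, path (cay_adj S) x p /\ last x p = y.
Proof.
move=> genS x y; have [s [sS xys]] := genS (x^-1 * y)%g.
have -> : y = (x * \prod_(a <- s) a)%g by rewrite -xys mulgA mulgV mul1g.
elim: s x sS {y xys} => [|a s IHs] x /=.
  by move=> _; exists [::]; rewrite big_nil mulg1.
case/andP=> aS sS; have [p [pp lp]] := IHs (x * a)%g sS.
rewrite big_cons mulgA -lp; have [xa|xa] := eqVneq x (x * a)%g.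
  by exists p; rewrite -xa in pp *.
exists ((x * a)%g :: p); split=> //=.
rewrite pp andbT; apply/andP; split=> //.
by rewrite mulgA mulVg mul1g.
Qed.

Definition Cay (S : {fset G}) (genS : generates S) : graph :=
  Graph (@cay_adj_sym S) (@cay_adj_irr S) (cay_connected genS).

End Cayley.

(* L wr Z is generated by the lamps at position 0 and a unit step. *)
Section FinitelyGenerated.
Variable L : finGroupType.

Definition lamp (k : int) (l : L) : lampconf L :=
  [fsfun j in [fset k]%fset => l | 1%g].
Definition ll_lamp k l : lamplighter L := (lamp k l, 0%R).
Definition ll_step (m : int) : lamplighter L := (lc_one L, m).
Definition ll_gens : {fset lamplighter L} :=
  (ll_step 1 |` [fset ll_lamp 0 l | l in L])%fset.

Lemma lampE k l j : lamp k l j = if j == k then l else 1%g.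
Proof. by rewrite /lamp fsfunE inE. Qed.

Lemma ll_mulE (x y : lamplighter L) : (x * y)%g = ll_mul x y.
Proof. by []. Qed.

Lemma ll_gens_generate : generates ll_gens.
Proof.
pose H (x : lamplighter L) := exists s : seq (lamplighter L),
  all (symgen ll_gens) s /\ x = (\prod_(a <- s) a)%g.
have H1 : H 1%g by exists [::]; rewrite big_nil.
have HM x y : H x -> H y -> H (x * y)%g.
  move=> [s [sS ->]] [t [tS ->]]; exists (s ++ t).
  by rewrite all_cat sS tS big_cat.
have Hgen a : symgen ll_gens a -> H a.
  by move=> aS; exists [:: a]; rewrite /= aS big_seq1.
have stepG : ll_step 1 \in ll_gens by rewrite !inE eqxx.
have stepD m p : ll_step (m + p) = (ll_step m * ll_step p)%g.
  rewrite ll_mulE /ll_mul /=; congr (_, _).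
  by apply/fsfunP=> k; rewrite lc_mulE lc_shiftE !lc_oneE mulg1.
have step0 : ll_step 0 = 1%g by [].
have stepN m : ll_step (- m) = (ll_step m)^-1%g.
  by apply/eqP; rewrite -mulg_eq1 -stepD addNr.
have Hstep m : H (ll_step m).
  elim/int_rec: m => [|n IHn|n IHn]; first by rewrite step0.
    rewrite -addn1 PoszD stepD; apply: HM => //.
    by apply: Hgen; rewrite /symgen /= stepG.
  rewrite -addn1 PoszD opprD stepD; apply: HM => //.
  by apply: Hgen; rewrite /symgen /= -stepN opprK stepG orbT.
have Hlamp k l : H (ll_lamp k l).
  have -> : ll_lamp k l = (ll_step k * ll_lamp 0 l * ll_step (- k))%g.
    rewrite !ll_mulE /ll_mul /=; congr (_, _); last by rewrite addr0 subrr.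
    apply/fsfunP=> j; rewrite !lc_mulE !lc_shiftE !lc_oneE !lampE.
    by rewrite mul1g mulg1 subr_eq0.
  apply: (HM) => //; apply: HM => //.
  apply: Hgen; rewrite /symgen /=; apply/orP; left.
  by rewrite !inE; apply/orP; right; apply/imfsetP; exists l.
have Hconf n : forall f : lampconf L, #|` finsupp f| <= n -> H (f, 0%R).
  elim: n => [|n IHn] f.
    rewrite leqn0 cardfs_eq0 => /eqP f0.
    suff -> : f = lc_one L by exact: Hstep.
    by apply/fsfunP=> k; rewrite lc_oneE fsfun_dflt // f0 inE.
  have [f0 _|[k kf]] := fset_0Vmem (finsupp f).
    by apply: IHn; rewrite f0 cardfs0.
  rewrite (cardfsD1 k) kf add1n ltnS => /= le.
  pose g : lampconf L := [fsfun f without k].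
  have -> : (f, 0%R) = (ll_lamp k (f k) * (g, 0%R))%g :> lamplighter L.
    rewrite ll_mulE /ll_mul /=; congr (_, _).
    apply/fsfunP=> j; rewrite lc_mulE lc_shiftE lampE subr0 fsfun_withE.
    by have [->|_] := eqVneq j k; rewrite ?mulg1 ?mul1g.
  by apply: HM => //; apply: IHn; rewrite finsupp_without.
move=> [f m].
have -> : (f, m) = (((f, 0%R) : lamplighter L) * ll_step m)%g :> lamplighter L.
  rewrite ll_mulE /ll_mul /=; congr (_, _); last by rewrite add0r.
  by apply/fsfunP=> k; rewrite lc_mulE lc_shiftE lc_oneE mulg1.
by apply: HM (Hstep m); apply: Hconf (leqnn _).
Qed.

End FinitelyGenerated.

Section Game.
Variables (G : graph) (n : nat).

Definition copsPos := 'I_n -> G.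
(* Moves are recorded as the sequence of vertices visited after the current
   position, so that [::] means standing still. *)
Definition copsMove := 'I_n -> seq G.
Definition robberMove := seq G.

Record play := Play {
  copStart : copsPos;
  robStart : G;
  copMv : nat -> copsMove;
  robMv : nat -> robberMove }.

Section Positions.
Variable p : play.

Fixpoint copPos (t : nat) : copsPos :=
  if t is t'.+1 then fun i => last (copPos t' i) (copMv p t' i)
  else copStart p.

Fixpoint robPos (t : nat) : G :=
  if t is t'.+1 then last (robPos t') (robMv p t') else robStart p.

Definition copTrace (t : nat) (i : 'I_n) : seq G := copPos t i :: copMv p t i.
Definition robTrace (t : nat) : seq G := robPos t :: robMv p t.

Definition cops_legal (sigma : nat) : Prop :=
  forall t i, path (@adj G) (copPos t i) (copMv p t i)
              /\ size (copMv p t i) <= sigma.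

Definition robber_legal (psi : nat) : Prop :=
  forall t, path (@adj G) (robPos t) (robMv p t) /\ size (robMv p t) <= psi.

(* Distances are checked at every vertex traversed by a cop or the robber.
   In stage t the robber first waits at [robPos t] while the cops move, and
   then moves while the cops wait at [copPos t.+1]. *)
Definition captured_at (rho t : nat) : Prop :=
  (exists i, exists2 c, c \in copTrace t i & gdist (robPos t) c <= rho) \/
  (exists i, exists2 r, r \in robTrace t & gdist r (copPos t.+1 i) <= rho).

Definition captured (rho : nat) : Prop := exists t, captured_at rho t.

Definition defended (v : G) (R : nat) : Prop :=
  exists T, forall t, T <= t -> forall r, r \in robTrace t -> R < gdist v r.

Definition history (t : nat) : seq (copsMove * robberMove) :=
  mkseq (fun s => (copMv p s, robMv p s)) t.

End Positions.

Record copStrategy := CopStrategy {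
  strat_start : copsPos;
  strat_move : G -> seq (copsMove * robberMove) -> copsMove }.

Definition follows (S : copStrategy) (p : play) : Prop :=
  copStart p = strat_start S /\
  forall t, copMv p t = strat_move S (robStart p) (history p t).

Definition cop_winning (v : G) (sigma psi rho R : nat) (S : copStrategy) :=
  forall p : play, follows S p -> robber_legal p psi ->
    cops_legal p sigma /\ (captured p rho \/ defended p v R).

Definition cops_win (v : G) (sigma psi rho R : nat) : Prop :=
  exists S : copStrategy, cop_winning v sigma psi rho R S.

End Game.

Definition strong_cops_win (G : graph) (n : nat) : Prop :=
  forall v : G,
  exists2 sigma : nat, 0 < sigma & forall psi : nat, 0 < psi ->
  exists2 rho : nat, 0 < rho & forall R : nat, 0 < R ->
  cops_win n v sigma psi rho R.

(* Infimum in N u {oo}, with inf of the empty set being oo. *)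
Definition inf_nat (A : set nat) : \bar nat :=
  if pselect (exists k, k \in A) is left exA then (ex_minn exA)%:E
  else +oo%E.

Definition sCop (G : graph) : \bar nat :=
  inf_nat [set n | 0 < n /\ strong_cops_win G n]%classic.

(* Main.v *)
Require Import Defs.
From mathcomp Require Import all_boot all_order all_algebra all_fingroup.
From mathcomp Require Import finmap constructive_ereal.
From mathcomp Require Import boolp zify.

Set Implicit Arguments.
Unset Strict Implicit.
Unset Printing Implicit Defensive.

Import GRing.Theory.

(** Write an element of the lamplighter group as a pair (f, m), with f the lamp
configuration and m the position of the lamplighter.  Up to a multiplicative
constant depending on S, two elements at distance at most k satisfy [near]: the
lamplighters are within k of each other and the lamps agree outside a window of
radius k around them.  So one lamp that differs from a cop's lamp and is far
from that cop protects the robber from that cop, wherever the robber is.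

Fix n cops.  The robber commutes between the positions 0 and M, where M is large
compared to the radius r of the windows that matter.  It uses the n lamps
0, ..., n - 1 and the n lamps M, ..., M + n - 1; lamps i and M + i are meant
for cop i.  At position 0 it faces only cops close to 0, and these it holds off
with the lamps M + i ([robber_inv]).  There it first makes every lamp i different
from lamp i of cop i, then walks to M, makes every lamp M + i different from lamp
M + i of cop i, and walks back ([robber_trail]).  During the round trip, cops far
to the right are held off by the lamps i, cops far to the left by the lamps
M + i ([spot_far]); as M is larger than the windows, every cop is of one of
these two kinds.  Afterwards a cop can have copied lamp M + i only by being close
to M, hence far from 0, so the invariant holds again ([right_lamp_kept]).

A round trip costs O(M) steps and M only has to exceed a multiple of
n + rho + (distance travelled by a cop meanwhile).  Hence a robber that is faster
than the cops by a constant factor, chosen before rho, can afford it in T stages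
once T is large ([lamplighter_robber_wins]).  The robber is never captured, and
it is at position 0 after each round trip with one of finitely many
configurations, so it comes back forever to one ball around the identity, whose
radius R may be chosen last.  Turning such a round trip into a play against an
arbitrary cop strategy is a fact about all graphs ([evasion]). *)

(** * Bounded paths in a graph *)

Section Reach.
Variable G : graph.
Implicit Types (x y z : G) (Q : G -> Prop).

Definition reach (k : nat) x y : Prop :=
  exists p, [/\ path (@adj G) x p, last x p = y & size p <= k].

Lemma reach_refl k x : reach k x x.
Proof. by exists [::]. Qed.

Lemma reach_trans k l x y z : reach k x y -> reach l y z -> reach (k + l) x z.
Proof.
move=> [p [px <- sp]] [q [qy <- sq]]; exists (p ++ q).
by rewrite cat_path px qy last_cat size_cat leq_add.
Qed.

Lemma reach_le k l x y : k <= l -> reach k x y -> reach l x y.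
Proof. by move=> kl [p [? ? sp]]; exists p; split=> //; exact: leq_trans kl. Qed.

Lemma reach_gdist x y : reach (gdist x y) x y.
Proof.
rewrite /gdist; case: ex_minnP => k /asboolP[p [px py <-]] _.
by exists p.
Qed.

Lemma reach_mem x p k y :
  path (@adj G) x p -> size p <= k -> y \in x :: p -> reach k x y.
Proof.
rewrite inE => xp pk /predU1P[->|]; first exact: reach_refl.
move=> yp; case/path.splitP: yp xp pk => p1 p2.
rewrite cat_path size_cat => /andP[xp1 _] /(leq_trans (leq_addr _ _)) pk.
by exists (rcons p1 y); rewrite last_rcons.
Qed.

(** Unlike [reach], a trail remembers that every vertex it visits satisfies [Q];
this is how the robber's journey is assembled from safe pieces. *)
Definition trail Q (k : nat) x y : Prop :=
  exists w, [/\ path (@adj G) x w, last x w = y, size w <= k &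
             forall z, z \in x :: w -> Q z].

Lemma trail_cat Q k l x y z :
  trail Q k x y -> trail Q l y z -> trail Q (k + l) x z.
Proof.
move=> [p [px py sp Qp]] [q [qy qz sq Qq]]; exists (p ++ q).
rewrite cat_path px last_cat size_cat leq_add // py; split=> // u.
rewrite -cat_cons mem_cat => /orP[/Qp//|uq].
by apply: Qq; rewrite inE uq orbT.
Qed.

Lemma trail_le Q k l x y : k <= l -> trail Q k x y -> trail Q l x y.
Proof.
by move=> kl [w [? ? sw ?]]; exists w; split=> //; exact: leq_trans kl.
Qed.

Lemma trail_reach Q k x y :
  reach k x y -> (forall z, reach k x z -> Q z) -> trail Q k x y.
Proof.
move=> [p [px py sp]] HQ; exists p; split=> // z zp.
exact: HQ (reach_mem px sp zp).
Qed.

Lemma trail_iter Q k (f : nat -> G) m : Q (f 0) ->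
  (forall j, j < m -> trail Q k (f j) (f j.+1)) -> trail Q (m * k) (f 0) (f m).
Proof.
move=> Q0; elim: m => [_|m IHm Hf].
  by exists [::]; split=> // z; rewrite inE => /eqP->.
rewrite mulSnr; apply: trail_cat (Hf _ (ltnSn m)).
by apply: IHm => j jm; apply: Hf; rewrite (ltn_trans jm).
Qed.

End Reach.

(** * From safe round trips to a win for the robber *)

Section Evasion.
Variables (G : graph) (n T sigma psi rho R : nat) (v : G).
Variable Inv : copsPos G n -> G -> Prop.
Hypothesis T_gt0 : 0 < T.
Hypothesis Inv_start : forall c, exists x, Inv c x.
Hypothesis Inv_near : forall c x, Inv c x -> gdist v x <= R.

(** In [T] stages a cop moves by at most [T * sigma], so a vertex that is safe
when a round starts stays out of reach of the cops during the whole round. *)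
Definition safe (c : copsPos G n) (y : G) : Prop :=
  forall i d, reach (T * sigma) (c i) d -> rho < gdist y d.

Hypothesis Inv_trail : forall c x, Inv c x -> exists y,
  trail (safe c) (T * psi) x y /\
  forall c', (forall i, reach (T * sigma) (c i) (c' i)) -> Inv c' y.

(** Outside the invariant only legality is required, which makes the plan a total
function of the positions. *)
Let good_plan (cx : copsPos G n * G) (w : seq G) : Prop :=
  path (@adj G) cx.2 w /\
  (Inv cx.1 cx.2 ->
    [/\ size w <= T * psi, forall z, z \in cx.2 :: w -> safe cx.1 z &
        forall c', (forall i, reach (T * sigma) (cx.1 i) (c' i)) ->
          Inv c' (last cx.2 w)]).

Lemma good_planP : {plan & forall cx, good_plan cx (plan cx)}.
Proof.
apply: boolp.choice => -[c x]; have [I|I] := pselect (Inv c x); last first.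
  by exists [::]; split.
have [y [[w [xw wy sw Qw]] Iy]] := Inv_trail I.
by exists w; split=> //= _; split=> //; rewrite wy.
Qed.

Section Play.
Variables (Str : copStrategy G n) (x0 : G).
Hypothesis start_inv : Inv (strat_start Str) x0.

Let plan := projT1 good_planP.

(** The cops' moves depend on the history and the robber's on the rest of its
current route, so both are generated together by one recursion. *)
Record state := State {
  st_hist : seq (copsMove G n * robberMove G);
  st_cops : copsPos G n;
  st_rob : G;
  st_rest : seq G }.

Definition route (t : nat) (st : state) : seq G :=
  if T %| t then plan (st_cops st, st_rob st) else st_rest st.

Definition next (t : nat) (st : state) : state :=
  let cm := strat_move Str x0 (st_hist st) in
  let w := route t st in
  State (rcons (st_hist st) (cm, take psi w))
    (fun i => last (st_cops st i) (cm i)) (last (st_rob st) (take psi w))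
    (drop psi w).

Fixpoint state_at (t : nat) : state :=
  if t is t'.+1 then next t' (state_at t')
  else State [::] (strat_start Str) x0 [::].

Definition evading_play : play G n :=
  Play (strat_start Str) x0 (fun t => strat_move Str x0 (st_hist (state_at t)))
    (fun t => take psi (route t (state_at t))).
Let p := evading_play.

Lemma copPosE t : copPos p t = st_cops (state_at t).
Proof. by elim: t => //= t ->. Qed.

Lemma robPosE t : robPos p t = st_rob (state_at t).
Proof. by elim: t => //= t ->. Qed.

Lemma historyE t : history p t = st_hist (state_at t).
Proof.
elim: t => // t IH.
by rewrite /history /mkseq -addn1 iotaD map_cat -/(mkseq _ t) -/(history p t) IH
   addn1 /= cats1.
Qed.

Lemma evading_play_follows : follows Str p.
Proof. by split=> // t; rewrite historyE. Qed.

Lemma path_drop (x : G) w k : path (@adj G) x w ->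
  path (@adj G) (last x (take k w)) (drop k w).
Proof. by rewrite -{1}(cat_take_drop k w) cat_path => /andP[]. Qed.

Lemma path_take (x : G) w k : path (@adj G) x w -> path (@adj G) x (take k w).
Proof. by rewrite -{1}(cat_take_drop k w) cat_path => /andP[]. Qed.

Lemma route_path t :
  path (@adj G) (st_rob (state_at t)) (route t (state_at t)).
Proof.
have plan_path c x : path (@adj G) x (plan (c, x)).
  by have [] := projT2 good_planP (c, x).
elim: t => [|t IH]; rewrite /route; first by rewrite dvdn0 plan_path.
by case: ifP => _; [exact: plan_path|exact: path_drop].
Qed.

(** Legality holds unconditionally: every route starts at the current position
and is cut to the robber's speed.  It has to, since the cops are known to be legal
only once the robber is. *)
Lemma evading_play_legal : robber_legal p psi.
Proof.
move=> t; rewrite robPosE /= size_take_min geq_minl; split=> //.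
exact: path_take (route_path t).
Qed.

Hypothesis legal : cops_legal p sigma.

Lemma copPos_reach t j i : reach (j * sigma) (copPos p t i) (copPos p (t + j) i).
Proof.
elim: j => [|j IH]; first by rewrite addn0; exact: reach_refl.
rewrite mulSnr addnS; apply: reach_trans IH _.
by have [? ?] := legal (t + j) i; exists (copMv p (t + j) i).
Qed.

Lemma copTrace_reach t j i c : j < T -> c \in copTrace p (t + j) i ->
  reach (T * sigma) (copPos p t i) c.
Proof.
move=> jT cT; have [pp sp] := legal (t + j) i.
apply: reach_le (reach_trans (copPos_reach t j i) (reach_mem pp sp cT)).
by rewrite -mulSnr leq_mul2r jT orbT.
Qed.

Section Round.
Variable k : nat.
Let t0 := k * T.
Let w := plan (copPos p t0, robPos p t0).
Hypothesis inv : Inv (copPos p t0) (robPos p t0).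

Lemma round_pos j : j <= T ->
  robPos p (t0 + j) = last (robPos p t0) (take (j * psi) w) /\
  (j < T -> route (t0 + j) (state_at (t0 + j)) = drop (j * psi) w).
Proof.
elim: j => [_|j IH jT].
  rewrite addn0 take0 drop0; split=> // _.
  by rewrite /route dvdn_mull // -copPosE -robPosE.
have [Ep /(_ jT) Er] := IH (ltnW jT).
split.
  rewrite addnS robPosE /= -robPosE Ep Er -last_cat; congr last.
  by rewrite mulSnr takeD.
move=> j1T; rewrite addnS /route -addnS dvdn_addr ?dvdn_mull //.
by rewrite gtnNdvd // addnS /= Er drop_drop mulSn.
Qed.

Lemma round_trace j r : j < T -> r \in robTrace p (t0 + j) ->
  r \in robPos p t0 :: w.
Proof.
move=> jT; have [Ep Er] := round_pos (ltnW jT).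
rewrite /robTrace Ep /= Er // inE => /predU1P[->|/mem_take/mem_drop].
  by have := mem_last (robPos p t0) (take (j * psi) w); rewrite !inE =>
    /predU1P[->|/mem_take ->]; rewrite ?eqxx ?orbT.
by rewrite inE => ->; rewrite orbT.
Qed.

(** Cops that move and a robber that moves are both covered: the robber stays on
the planned route, and all cop vertices of the round are within [T * sigma] of
the cop positions used for planning. *)
Lemma round_safe j : j < T -> ~ captured_at p rho (t0 + j).
Proof.
have [_ /(_ inv)[sw Sw _]] := projT2 good_planP (copPos p t0, robPos p t0).
move=> jT [[i [c cT]]|[i [r rT]]]; apply/negP; rewrite -ltnNge.
  apply: Sw (copTrace_reach jT cT).
  by apply: (round_trace jT); rewrite mem_head.
apply: (Sw _ (round_trace jT rT) i); rewrite -addnS.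
apply: reach_le (copPos_reach t0 j.+1 i).
by rewrite leq_mul2r jT orbT.
Qed.

Lemma round_inv : Inv (copPos p (k.+1 * T)) (robPos p (k.+1 * T)).
Proof.
have [_ /(_ inv)[sw _ Iw]] := projT2 good_planP (copPos p t0, robPos p t0).
rewrite mulSnr -/t0; have [-> _] := round_pos (leqnn T).
rewrite take_oversize //; apply: Iw => i; exact: copPos_reach.
Qed.

End Round.

Lemma rounds_inv k : Inv (copPos p (k * T)) (robPos p (k * T)).
Proof. by elim: k => // k; apply: round_inv. Qed.

Lemma never_captured : ~ captured p rho.
Proof.
move=> [t]; rewrite (divn_eq t T); apply: round_safe (rounds_inv _) _ _.
by rewrite ltn_mod.
Qed.

Lemma never_defended : ~ defended p v R.
Proof.
move=> [t0 Ht]; have := Ht (t0 * T) (leq_pmulr _ T_gt0) _ (mem_head _ _).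
by rewrite ltnNge (Inv_near (rounds_inv t0)).
Qed.

End Play.

(** If from every position satisfying the invariant the robber has a path of at
most [T * psi] edges, safe for the next [T] stages, that restores the invariant
whatever the cops do meanwhile, and the invariant keeps the robber within [R] of
[v], then repeating such rounds is never captured and never stops visiting the
ball around [v]. *)
Lemma evasion : ~ cops_win n v sigma psi rho R.
Proof.
move=> [Str win]; have [x0 I0] := Inv_start (strat_start Str).
have [] := win _ (evading_play_follows Str x0) (@evading_play_legal Str x0).
move=> legal; case; first exact: never_captured.
exact: never_defended.
Qed.

End Evasion.

(** * Distances in the lamplighter group *)

Section CayleyAction.
Variables (G : groupType) (S : {fset G}) (genS : generates S).

Lemma cay_adjP (x y : G) : cay_adj S x y ->
  (exists2 s, s \in S & y = (x * s)%g) \/ (exists2 s, s \in S & x = (y * s)%g).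
Proof.
case/andP=> _ /orP[xyS|xyS]; [left|right]; eexists; try exact: xyS.
  by rewrite mulKVg.
by rewrite invgM invgK mulKVg.
Qed.

(** Left multiplication is an automorphism of the Cayley graph. *)
Lemma reach_mul k (x y : Cay genS) (z : G) :
  reach k x y -> reach k ((z * x)%g : Cay genS) (z * y)%g.
Proof.
move=> [p [xp <- sp]]; exists (map (mul z) p).
rewrite size_map last_map; split=> //.
elim: p x xp {sp} => //= u p IH x /andP[xu /IH ->]; rewrite andbT.
move: xu; rewrite /cay_adj /= (inj_eq (mulgI _)).
by rewrite invgM -mulgA mulKg.
Qed.

End CayleyAction.

Section Near.
Variable L : groupType.
Implicit Types x y z : lamplighter L.

(** A lower bound for the word metric: within k steps only lamps near the
lamplighter change.  Asking this around both endpoints makes the relation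
symmetric. *)
Definition near (k : nat) x y : Prop :=
  (absz (x.2 - y.2)%R <= k) /\
  forall j, x.1 j != y.1 j ->
    (absz (j - x.2)%R <= k) && (absz (j - y.2)%R <= k).

Lemma near_sym k x y : near k x y -> near k y x.
Proof.
move=> [h d]; split; first by lia.
by move=> j; rewrite eq_sym andbC; apply: d.
Qed.

Lemma near_trans k l x y z : near k x y -> near l y z -> near (k + l) x z.
Proof.
move=> [hxy dxy] [hyz dyz]; split; first by lia.
move=> j; have [Exy|/dxy] := eqVneq (x.1 j) (y.1 j); last by lia.
by rewrite Exy => /dyz; lia.
Qed.

Lemma near_le k l x y : k <= l -> near k x y -> near l x y.
Proof.
move=> kl [h d]; split; first by lia.
by move=> j /d; lia.
Qed.

(** Multiplying by [s] on the right moves the lamplighter and touches lamps at most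
this far away. *)
Definition spread (s : lamplighter L) : nat :=
  \max_(j <- finsupp s.1) absz j + absz s.2.

Definition max_spread (S : {fset lamplighter L}) : nat :=
  \max_(s <- S) spread s.

Lemma near_mul x s : near (spread s) x (x * s)%g.
Proof.
case: x s => f m [g p]; rewrite /spread /near /=; split; first by lia.
move=> j; rewrite /= lc_mulE lc_shiftE eq_sym -[X in _ != X]mulg1.
rewrite (inj_eq (mulgI _)) -mem_finsupp => jg.
have : absz (j - m)%R <= \max_(j <- finsupp g) absz j by apply: leq_bigmax_seq.
move: (bigop _ _ _) => B hB; lia.
Qed.

(** Each edge of the Cayley graph changes things only within [max_spread S]. *)
Lemma near_reach (S : {fset lamplighter L}) (genS : generates S) k
    (x y : Cay genS) :
  reach k x y -> near (max_spread S * k) x y.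
Proof.
set C := max_spread S => -[p [xp <- sp]].
suff : near (C * size p) x (last x p).
  by apply: near_le; rewrite leq_mul2l sp orbT.
have adjP (a b : lamplighter L) : cay_adj S a b -> near C a b.
  have genP c s : s \in S -> near C c (c * s)%g.
    by move=> sS; apply: near_le (near_mul c s); apply: leq_bigmax_seq.
  by case/cay_adjP=> -[s sS ->]; [|apply: near_sym]; apply: genP.
elim: p x {xp sp} (xp) => [|z p IH] x /=.
  by move=> _; split=> [|j]; rewrite ?eqxx //; lia.
by case/andP=> /adjP xz /IH; rewrite mulnS; apply: near_trans.
Qed.

End Near.

(** * The robber's configurations *)

Section Configurations.
Variables (L : finGroupType) (n M : nat).
Implicit Types a b : {ffun 'I_n -> L}.

(** A cop that moves within radius [r] and copies a lamp beyond M must have been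
near that lamp, so it is still to the right of n + r. *)
Lemma right_lamp_kept r b (g g' : lamplighter L) (i : 'I_n) : n + r.*2 < M ->
  near r g g' -> b i != g.1 (Posz (M + i)) ->
  (Posz (n + r) < g'.2)%R \/ b i != g'.1 (Posz (M + i)).
Proof.
case: g g' => [f p] [f' p'] rM [/= _ diff] bf.
have [bf'|] := eqVneq (b i) (f' (Posz (M + i))); last by right.
by left; move: bf; rewrite bf' eq_sym => /diff; lia.
Qed.

Hypothesis n_le_M : n <= M.

(** The lamps 0, ..., n - 1 set to [a]. *)
Definition lamp_row a : lampconf L :=
  [fsfun j in [fset Posz (val i) | i in 'I_n]%fset =>
     oapp a 1%g (insub (absz j)) | 1%g].

Lemma lamp_row_in a (i : 'I_n) : lamp_row a (Posz i) = a i.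
Proof.
rewrite /lamp_row fsfunE in_imfset //= insubT //= => ni.
by congr (a _); apply: val_inj.
Qed.

Lemma lamp_row_out a (j : int) :
  (forall i : 'I_n, j <> Posz i) -> lamp_row a j = 1%g.
Proof.
move=> jn; rewrite /lamp_row fsfunE; case: ifP => // /imfsetP[i _ ji].
by case: (jn i).
Qed.

Definition conf a b : lampconf L :=
  lc_mul (lamp_row a) (lc_shift (Posz M) (lamp_row b)).
Definition spot a b (k : nat) : lamplighter L := (conf a b, Posz k).

Lemma conf_left a b (i : 'I_n) : conf a b (Posz i) = a i.
Proof.
rewrite lc_mulE lc_shiftE lamp_row_in lamp_row_out ?mulg1 // => j.
have := ltn_ord i; lia.
Qed.

Lemma conf_right a b (i : 'I_n) : conf a b (Posz (M + i)) = b i.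
Proof.
rewrite lc_mulE lc_shiftE lamp_row_out ?mul1g => [|j]; last first.
  have := ltn_ord j; lia.
by rewrite -(lamp_row_in b i); congr (lamp_row b _); lia.
Qed.

(** The group element setting the lamps [a] to [a'] is independent of M, so its
cost is bounded before M is chosen. *)
Definition change a a' : {ffun 'I_n -> L} := [ffun i => (a i)^-1 * a' i]%g.
Definition ll_row a : lamplighter L := (lamp_row a, 0%R).

Lemma lamp_row_change a a' j :
  (lamp_row a j * lamp_row (change a a') j)%g = lamp_row a' j.
Proof.
have [[i ->]|jn] := pselect (exists i : 'I_n, j = Posz i).
  by rewrite !lamp_row_in ffunE mulKVg.
by rewrite !lamp_row_out ?mulg1 // => i ji; apply: jn; exists i.
Qed.

Lemma spot_left a a' b : (spot a b 0 * ll_row (change a a'))%g = spot a' b 0.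
Proof.
rewrite ll_mulE /ll_mul /=; congr (_, _); apply/fsfunP => j.
rewrite !(lc_mulE, lc_shiftE) subr0.
have [[i ->]|jn] := pselect (exists i : 'I_n, j = Posz i).
  rewrite (lamp_row_out b) ?mulg1 ?lamp_row_change // => i'; have := ltn_ord i; lia.
by rewrite !(@lamp_row_out _ j) ?mulg1 // => i ji; apply: jn; exists i.
Qed.

Lemma spot_right a b b' : (spot a b M * ll_row (change b b'))%g = spot a b' M.
Proof.
rewrite ll_mulE /ll_mul /=; congr (_, _); last by rewrite addr0.
by apply/fsfunP => j; rewrite !(lc_mulE, lc_shiftE) -mulgA lamp_row_change.
Qed.

Lemma spot_step a b k (p : int) l : (Posz k + p)%R = Posz l ->
  (spot a b k * ll_step L p)%g = spot a b l.
Proof.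
move=> kl; rewrite ll_mulE /ll_mul /= kl; congr (_, _); apply/fsfunP => j.
by rewrite lc_mulE lc_shiftE lc_oneE mulg1.
Qed.

(** One lamp per cop suffices.  A cop to the right of n + r has its window beyond
lamp i < n, so a different lamp i separates it from the robber; any other cop has
its window to the left of lamp M + i, since n + 2r < M.  At position 0 the cops of
the first kind are too far away to matter, which is the case [k = 0]. *)
Lemma spot_far r a b k (g : lamplighter L) (i : 'I_n) : n + r.*2 < M ->
  ((Posz (n + r) < g.2)%R -> k = 0 \/ a i != g.1 (Posz i)) ->
  ((g.2 <= Posz (n + r))%R -> b i != g.1 (Posz (M + i))) ->
  ~ near r (spot a b k) g.
Proof.
case: g => h p /= rM right left [/= kg diff]; have i_lt := ltn_ord i.
have [pr|pl] : (p <= Posz (n + r))%R \/ (Posz (n + r) < p)%R by lia.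
  move: (left pr); rewrite -(conf_right a b) => /diff; lia.
by case: (right pl) => [k0|]; [lia|rewrite -(conf_left a b) => /diff; lia].
Qed.

End Configurations.

Lemma nontrivial_other (L : finGroupType) (x : L) : 1 < #|L| -> {y | y != x}.
Proof.
move=> L1; apply/sigW; have [y yx|L0] := pickP [pred y | y != x].
  by exists y.
move: L1; rewrite (@eq_card1 _ x) // => y; have := L0 y.
by rewrite /= inE => /negbFE.
Qed.

(** * The round trip *)

Section Robber.
Variables (L : finGroupType) (L_nontrivial : 1 < #|L|).
Variables (S : {fset lamplighter L}) (genS : generates S).
Variable n : nat.

Let C := max_spread S.
Local Notation one := (1%g : Cay genS).

Definition move_cost : nat :=
  gdist one (ll_step L 1) + gdist one (ll_step L (-1)) +
  \max_(a : {ffun 'I_n -> L}) gdist one (ll_row a).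
Let D := move_cost.

Lemma move_costP (x : Cay genS) (s : lamplighter L) :
  gdist one s <= D -> reach D x (x * s : lamplighter L)%g.
Proof.
move=> sD; have := reach_mul x (reach_le sD (reach_gdist one (s : Cay genS))).
by rewrite mulg1.
Qed.

Variables (T sigma rho : nat).
(** A capture within rho, a detour of length D off the chosen spots, and the
cops' motion during T stages all add up. *)
Let r := C * (rho + D + T * sigma).
Let M := (n + r.*2).+1.

(** At position 0 the robber is exposed to the cops on the left only, so only those
must be held off by a lamp on the right. *)
Definition robber_inv (c : copsPos (Cay genS) n) (x : Cay genS) : Prop :=
  exists a b, x = spot M a b 0 /\
    forall i, (Posz (n + r) < (c i).2)%R \/ b i != (c i).1 (Posz (M + i)).

Lemma safe_around (c : copsPos (Cay genS) n) (z y : Cay genS) :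
  (forall i, ~ near r z (c i)) -> reach D z y -> safe T sigma rho c y.
Proof.
move=> zfar zy i d cd; rewrite ltnNge; apply/negP => yd; apply: (zfar i).
have near_zy := near_reach zy.
have near_yd := near_reach (reach_le yd (reach_gdist y d)).
have near_dc := near_sym (near_reach cd).
apply: near_le (near_trans (near_trans near_zy near_yd) near_dc).
by rewrite -!mulnDr (addnC D).
Qed.

(** There are M moves for each of the two walks and one for each of the two
changes of lamps, so 2 (M + 1) moves of cost D. *)
Lemma robber_trail psi (c : copsPos (Cay genS) n) x :
  D * (M.+1).*2 <= T * psi -> robber_inv c x ->
  exists y, trail (safe T sigma rho c) (T * psi) x y /\
    forall c', (forall i, reach (T * sigma) (c i) (c' i)) -> robber_inv c' y.
Proof.
move=> bound [a [b [-> inv]]].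
pose other (y : L) := sval (nontrivial_other y L_nontrivial).
have otherP y : other y != y by rewrite /other; case: nontrivial_other.
pose a' : {ffun 'I_n -> L} := [ffun i => other ((c i).1 (Posz (i : 'I_n)))].
pose b' : {ffun 'I_n -> L} := [ffun i => other ((c i).1 (Posz (M + i)))].
have nM : n <= M by rewrite /M; lia.
have rM : n + r.*2 < M by [].
have a'P i : a' i != (c i).1 (Posz i) by rewrite ffunE.
have b'P i : b' i != (c i).1 (Posz (M + i)) by rewrite ffunE.
have bP i : ((c i).2 <= Posz (n + r))%R -> b i != (c i).1 (Posz (M + i)).
  by case: (inv i) => //; case: (c i) => ? ? /=; lia.
have move_trail (z z' : Cay genS) s : gdist one s <= D ->
    (z * s : lamplighter L)%g = z' -> (forall i, ~ near r z (c i)) ->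
    trail (safe T sigma rho c) D z z'.
  move=> sD <- zfar; apply: trail_reach (move_costP z sD) _ => y.
  exact: safe_around.
have step_le : gdist one (ll_step L 1) <= D by rewrite /D /move_cost; lia.
have back_le : gdist one (ll_step L (-1)) <= D by rewrite /D /move_cost; lia.
have row_le (d : {ffun 'I_n -> L}) : gdist one (ll_row d) <= D.
  have := leq_bigmax (F := fun e => gdist one (ll_row e)) d.
  by move/leq_trans; apply; apply: leq_addl.
(* During the first piece the lamps on the left are arbitrary, but k = 0. *)
have far0 i : ~ near r (spot M a b 0) (c i).
  by apply: (spot_far nM rM _ (@bP i)) => _; left.
have far1 k i : ~ near r (spot M a' b k) (c i).
  by apply: (spot_far nM rM _ (@bP i)) => _; right.
have far2 k i : ~ near r (spot M a' b' k) (c i).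
  by apply: (spot_far nM rM _ (fun=> b'P i)) => _; right.
exists (spot M a' b' 0 : Cay genS); split; last first.
  move=> c' cc'; exists a', b'; split=> // i.
  apply: (right_lamp_kept rM _ (b'P i)); apply: near_le (near_reach (cc' i)).
  by rewrite leq_mul2l leq_addl orbT.
have t1 := move_trail _ _ _ (row_le (change a a')) (spot_left nM a a' b) far0.
have t3 := move_trail _ _ _ (row_le (change b b')) (spot_right _ a' b b')
  (far1 M).
have t2 : trail (safe T sigma rho c) (M * D)
    (spot M a' b 0 : Cay genS) (spot M a' b M).
  apply: (trail_iter (f := spot M a' b : nat -> Cay genS)) => [|k _].
    exact: safe_around (far1 0) (reach_refl _ _).
  by apply: move_trail step_le _ (far1 k); apply: spot_step; lia.
have t4 : trail (safe T sigma rho c) (M * D)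
    (spot M a' b' M : Cay genS) (spot M a' b' 0).
  pose f k : Cay genS := spot M a' b' (M - k).
  rewrite -[in X in trail _ _ X _](subn0 M) -[in X in trail _ _ _ X](subnn M).
  rewrite -/(f 0) -/(f M).
  apply: trail_iter => [|k kM].
    exact: safe_around (far2 _) (reach_refl _ _).
  by apply: move_trail back_le _ (far2 _); apply: spot_step; lia.
apply: trail_le (trail_cat (trail_cat (trail_cat t1 t2) t3) t4).
by apply: leq_trans bound; lia.
Qed.

Lemma robber_start (c : copsPos (Cay genS) n) : exists x, robber_inv c x.
Proof.
pose b : {ffun 'I_n -> L} :=
  [ffun i => sval (nontrivial_other ((c i).1 (Posz (M + i))) L_nontrivial)].
exists (spot M b b 0), b, b; split=> // i; right.
by rewrite ffunE; case: nontrivial_other.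
Qed.

(** There are only finitely many choices of [a] and [b]. *)
Lemma robber_near :
  exists2 R, 0 < R & forall c x, robber_inv c x -> gdist one x <= R.
Proof.
pose F (ab : {ffun 'I_n -> L} * {ffun 'I_n -> L}) :=
  gdist one (spot M ab.1 ab.2 0).
exists (\max_ab F ab).+1 => // c x [a [b [-> _]]].
by apply: leqW; apply: (leq_bigmax (F := F) (a, b)).
Qed.

End Robber.

(** The number of moves in a round trip is 2 (M + 1) = T + 4 C T sigma for the
value of T below, so a speed of D (1 + 4 C sigma), independent of rho, lets T
stages suffice; one more unit makes the speed positive whatever D is. *)
Lemma lamplighter_robber_wins (L : finGroupType) (L_nontrivial : 1 < #|L|)
    (S : {fset lamplighter L}) (genS : generates S) n :
  ~ strong_cops_win (Cay genS) n.
Proof.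
move=> /(_ (1%g : lamplighter L)) [sigma _].
set C := max_spread S; set D := move_cost genS n.
move=> /(_ (D * (4 * C * sigma).+1).+1 isT) [rho _ win].
pose T := 2 * n + 4 + 4 * (C * (rho + D)).
have [R R0 HR] := robber_near genS n T sigma rho.
apply: (evasion (T := T) _ _ HR _ (win R R0)); first by rewrite /T; lia.
  exact: robber_start.
move=> c x; apply: robber_trail => //.
rewrite -/C -/D -addnn.
set m := (n + _).+2.
have -> : m + m = T * (4 * C * sigma).+1 by rewrite /m /T; lia.
by rewrite mulnCA leq_mul2l leqnSn orbT.
Qed.

Theorem theorem1p5 (L : finGroupType) (L_nontrivial : 1 < #|L|)
    (S : {fset lamplighter L}) (genS : generates S) :
  sCop (Cay genS) = +oo%E.
Proof.
rewrite /sCop /inf_nat; case: pselect => // -[n nA]; exfalso.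
move: nA; rewrite classical_sets.in_setE => -[_].
by move/(lamplighter_robber_wins L_nontrivial).
Qed.
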